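(* For $y_h=(p_h,\theta_h)\in Q_h\times\Psi_h$ let $\boldsymbol u_{y,h}\in\boldsymbol V_h$ (the discrete elastic lift) be defined by $$a_{\boldsymbol u}(\boldsymbol u_{y,h},\boldsymbol v_h)+b_p(p_h,\boldsymbol v_h)+b_\theta(\theta_h,\boldsymbol v_h)=0\qquad\forall\boldsymbol v_h\in\boldsymbol V_h,$$ and define the discrete effective mass form $$m_{{\rm eff},h}(y_h,z_h):=(\boldsymbol Sy_h,z_h)_\Omega+a_{\boldsymbol u}(\boldsymbol u_{y,h},\boldsymbol u_{z,h}),\qquad y_h,z_h\in Q_h\times\Psi_h.$$ There exists $C_{\rm eff}>0$, independent of $h$, such that $$m_{{\rm eff},h}(y_h,y_h)\ge C_{\rm eff}\bigl(\|p_h\|_{L^2(\Omega)}^2+\|\theta_h\|_{L^2(\Omega)}^2\bigr)\qquad\forall y_h=(p_h,\theta_h)\in Q_h\times\Psi_h.$$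
   Context: $\Omega\subset\mathbb R^d$, $d\in\{2,3\}$, is a bounded domain with Lipschitz polygonal/polyhedral boundary, with disjoint partitions $\partial\Omega=\Gamma_p\cup\Gamma_f=\Gamma_d\cup\Gamma_t=\Gamma_\theta\cup\Gamma_{\theta,f}$ with $|\Gamma_p|,|\Gamma_d|,|\Gamma_t|,|\Gamma_\theta|>0$. Spaces (with $H^1$ norms): $\boldsymbol V=\{\boldsymbol v\in H^1(\Omega;\mathbb R^d):\boldsymbol v|_{\Gamma_d}=0\}$, $Q=\{q\in H^1(\Omega):q|_{\Gamma_p}=0\}$, $\Psi=\{\psi\in H^1(\Omega):\psi|_{\Gamma_\theta}=0\}$; $(\cdot,\cdot)_\Omega$ is the $L^2(\Omega)$ inner product. $a_{\boldsymbol u}(\boldsymbol v,\boldsymbol w)=(\boldsymbol{\mathcal C}\epsilon(\boldsymbol v),\epsilon(\boldsymbol w))_\Omega$ with $\epsilon(\boldsymbol v)=\frac12(\nabla\boldsymbol v+(\nabla\boldsymbol v)^T)$ and elastic stiffness tensor $\boldsymbol{\mathcal C}$ (so $a_{\boldsymbol u}$ is symmetric, bounded and coercive on $\boldsymbol V$); $b_p(q,\boldsymbol v)=-\alpha_p(q,\operatorname{div}\boldsymbol v)_\Omega$, $b_\theta(\psi,\boldsymbol v)=-\alpha_\theta(\psi,\operatorname{div}\boldsymbol v)_\Omega$ with constants $\alpha_p,\alpha_\theta>0$. The constant matrix $\boldsymbol S=\begin{pmatrix}s_{pp}&s_{p\theta}\\ s_{\theta p}&s_{\theta\theta}\end{pmatrix}$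 is symmetric positive semidefinite and satisfies the effective storage condition $\alpha_\theta^2 s_{pp}-2\alpha_p\alpha_\theta s_{p\theta}+\alpha_p^2 s_{\theta\theta}\ge C_s>0$. $\boldsymbol V_h\times Q_h\times\Psi_h\subset\boldsymbol V\times Q\times\Psi$ are finite element spaces of continuous piecewise polynomials on a shape-regular family of simplicial partitions $\{\mathcal T_h\}$ of $\overline\Omega$, satisfying the inf-sup condition: there is $C>0$ independent of $h$ such that for every $\chi_h\in\alpha_pQ_h+\alpha_\theta\Psi_h$, $\|\chi_h\|_{L^2(\Omega)}\le C\sup_{0\neq\boldsymbol v_h\in\boldsymbol V_h}|(\chi_h,\operatorname{div}\boldsymbol v_h)_\Omega|/\|\boldsymbol v_h\|_{\boldsymbol V}$. *)

(* Defs.v *)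
From HB Require Import structures.
From mathcomp Require Import all_boot all_order all_algebra.
From mathcomp Require Import all_classical all_reals all_analysis.

Set Implicit Arguments.
Unset Strict Implicit.
Unset Printing Implicit Defensive.
Import Order.TTheory GRing.Theory Num.Theory.
Import numFieldNormedType.Exports.

Local Open Scope classical_set_scope.
Local Open Scope ring_scope.

Definition rV_display : measure_display -> measure_display.
Proof. exact. Qed.

(* The sigma-algebra on 'rV[T]_n is generated by the coordinates; for T = R it
   is the Borel sigma-algebra of the canonical topology. *)
Section rV_measurable.
Context {d} {T : sigmaRingType d} (n : nat).

Let coord (i : 'I_n) (x : 'rV[T]_n) : T := x ord0 i.

Let rV_set0 : g_sigma_preimage coord set0.
Proof. exact: sigma_algebra0. Qed.

Let rV_setC A : g_sigma_preimage coord A -> g_sigma_preimage coord (~` A).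
Proof. exact: sigma_algebraC. Qed.

Let rV_bigcup (F : (set 'rV[T]_n)^nat) :
  (forall i, g_sigma_preimage coord (F i)) ->
  g_sigma_preimage coord (\bigcup_i (F i)).
Proof. exact: sigma_algebra_bigcup. Qed.

HB.instance Definition _ := @isMeasurable.Build (rV_display d)
  'rV[T]_n (g_sigma_preimage coord) rV_set0 rV_setC rV_bigcup.

End rV_measurable.

Section rV_measurable_theory.
Context {R : realType}.

Lemma measurable_rV_coord n (i : 'I_n) :
  measurable_fun [set: 'rV[R]_n] (fun x => x ord0 i).
Proof.
move=> _ Y mY; rewrite setTI; apply: sub_sigma_algebra => /=.
rewrite -bigcup_seq/=; exists i => /=; first by rewrite mem_index_enum.
by exists Y => //; rewrite setTI.
Qed.

Lemma measurable_fun_rV d (T : measurableType d) n (f : T -> 'rV[R]_n) :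
  (forall i, measurable_fun [set: T] (fun t => f t ord0 i)) ->
  measurable_fun [set: T] f.
Proof.
move=> mf _ A mA; rewrite setTI.
suff : g_sigma_preimage (fun (i : 'I_n) (x : 'rV[R]_n) => x ord0 i) `<=`
    [set A | measurable (f @^-1` A)] by exact.
apply: smallest_sub.
  split=> /=.
  - by rewrite preimage_set0.
  - by move=> B mB; rewrite setTD preimage_setC; exact: measurableC.
  - by move=> F mF; rewrite preimage_bigcup; exact: bigcup_measurable.
rewrite -bigcup_seq; apply: bigcup_sub => i _ B [C mC <-] /=.
by rewrite setTI; have := mf i measurableT C mC; rewrite setTI.
Qed.

Definition rvcons n (p : R * 'rV[R]_n) : 'rV[R]_n.+1 :=
  \row_i oapp (fun j => p.2 ord0 j) p.1 (unlift ord0 i).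

Definition rvsplit n (x : 'rV[R]_n.+1) : R * 'rV[R]_n :=
  (x ord0 ord0, \row_j x ord0 (lift ord0 j)).

Lemma rvconsK n : cancel (@rvcons n) (@rvsplit n).
Proof.
case=> a v; congr pair; first by rewrite mxE unlift_none.
by apply/rowP => j; rewrite !mxE liftK.
Qed.

Lemma measurable_rvcons n : measurable_fun [set: R * 'rV[R]_n] (@rvcons n).
Proof.
apply: measurable_fun_rV => i.
rewrite (_ : (fun t => _) = fun t : R * 'rV[R]_n =>
    oapp (fun j => t.2 ord0 j) t.1 (unlift ord0 i)); last first.
  by apply/funext => t; rewrite mxE.
case: (unlift ord0 i) => [j|] /=; last exact: measurable_fst.
exact: (measurableT_comp (measurable_rV_coord j) measurable_snd).
Qed.

Lemma measurable_rvsplit n : measurable_fun [set: 'rV[R]_n.+1] (@rvsplit n).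
Proof.
apply/measurable_fun_pairP; split; first exact: measurable_rV_coord.
apply: measurable_fun_rV => j.
rewrite (_ : (fun t => _) = fun t : 'rV[R]_n.+1 => t ord0 (lift ord0 j)).
  exact: measurable_rV_coord.
by apply/funext => t; rewrite /= mxE.
Qed.

End rV_measurable_theory.

Section rV_lebesgue.
Context {R : realType}.

Section step.
Context (n : nat) (m : {sigma_finite_measure set 'rV[R]_n -> \bar R}).

Definition rvcons_measure : set 'rV[R]_n.+1 -> \bar R :=
  pushforward (@lebesgue_measure R \x m)%E (@rvcons R n).

Let rvcons_measure0 : rvcons_measure set0 = 0%E.
Proof. by rewrite /rvcons_measure /pushforward preimage_set0 measure0. Qed.

Let rvcons_measure_ge0 A : (0 <= rvcons_measure A)%E.
Proof. by rewrite /rvcons_measure /pushforward measure_ge0. Qed.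

Let rvcons_measure_sigma_additive : semi_sigma_additive rvcons_measure.
Proof.
move=> F mF tF mUF; rewrite /rvcons_measure /pushforward preimage_bigcup.
have mcons B : measurable B -> measurable (@rvcons R n @^-1` B).
  by move=> mB; rewrite -[X in measurable X]setTI; exact: measurable_rvcons.
apply: measure_semi_sigma_additive.
- by move=> k; exact: mcons.
- apply/trivIsetP => /= i j _ _ ij; rewrite -preimage_setI.
  by move/trivIsetP : tF => /(_ _ _ _ _ ij) ->//; rewrite preimage_set0.
- by rewrite -preimage_bigcup; exact: mcons.
Qed.

HB.instance Definition _ := isMeasure.Build _ _ _ rvcons_measure
  rvcons_measure0 rvcons_measure_ge0 rvcons_measure_sigma_additive.

Let rvcons_measure_sigma_finite : sigma_finite setT rvcons_measure.
Proof.
have /sigma_finiteP[F [TF ndF Foo]] := sigma_finiteT (@lebesgue_measure R).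
have /sigma_finiteP[G [TG ndG Goo]] := sigma_finiteT m.
exists (fun k => @rvsplit R n @^-1` (F k `*` G k)).
  rewrite -preimage_bigcup (_ : \bigcup_k _ = setT) ?preimage_setT//.
  apply/seteqP; split => // -[x y] _.
  have [i _ Fx] : (\bigcup_k F k) x by rewrite -TF.
  have [j _ Gy] : (\bigcup_k G k) y by rewrite -TG.
  exists (maxn i j) => //; split.
  - by move: x Fx; exact/subsetPset/ndF/leq_maxl.
  - by move: y Gy; exact/subsetPset/ndG/leq_maxr.
move=> k; have [mF Fk] := Foo k; have [mG Gk] := Goo k; split.
  rewrite -[X in measurable X]setTI; apply: measurable_rvsplit => //.
  exact: measurableX.
rewrite /rvcons_measure /pushforward -comp_preimage.
rewrite (_ : @rvsplit R n \o _ = id); last exact/funext/rvconsK.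
by rewrite preimage_id product_measure1E// lte_mul_pinfty// ge0_fin_numE.
Qed.

HB.instance Definition _ := Measure_isSigmaFinite.Build _ _ _ rvcons_measure
  rvcons_measure_sigma_finite.

End step.

Fixpoint lebesgue_rV n : {sigma_finite_measure set 'rV[R]_n -> \bar R} :=
  if n is n'.+1 then rvcons_measure (lebesgue_rV n') else dirac (0 : 'rV[R]_0).

End rV_lebesgue.

Notation h1fun R d :=
  ((('rV[R]_d -> R) * ('I_d -> 'rV[R]_d -> R))%type) (only parsing).

Section geometry.
Context {R : realType} {d : nat}.
Local Notation X := 'rV[R]_d.
Implicit Types (x y : X) (E A Omega : set X).

Definition edot x y : R := \sum_(i < d) x ord0 i * y ord0 i.

(* The norm `|x| of the library on 'rV[R]_d is the sup norm. *)
Definition enorm x : R := Num.sqrt (edot x x).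

Definition ediam E : \bar R :=
  ereal_sup ([set 0%E] `|` [set (enorm (p.1 - p.2))%:E | p in E `*` E]).

(* s-dimensional Hausdorff measure for s > 0, without the usual dimensional
   constant: for s = d - 1 it is a constant multiple of the surface measure. *)
Definition hausdorff_delta (s : nat) (delta : R) A : \bar R :=
  ereal_inf [set (\sum_(0 <= k <oo) ediam (F k) ^+ s)%E
            | F in [set F : (set X)^nat | A `<=` \bigcup_k F k /\
                      forall k, (ediam (F k) <= delta%:E)%E]].

Definition hausdorff (s : nat) A : \bar R :=
  ereal_sup [set hausdorff_delta s delta A | delta in [set t : R | 0 < t]].

Definition surface : set X -> \bar R := hausdorff d.-1.

Definition bnd Omega : set X := closure Omega `\` Omega°.

Definition polyhedral_boundary Omega : Prop :=
  exists2 planes : seq (X * R),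
    (forall p, p \in planes -> p.1 != 0) &
    bnd Omega `<=`
      [set x | exists2 p, p \in planes & edot p.1 x = p.2].

(* Near each boundary point Omega is the strict epigraph, in some direction
   e, of a Lipschitz function gam of the coordinates orthogonal to e. *)
Definition lipschitz_boundary Omega : Prop :=
  forall x, bnd Omega x ->
  exists (e : X) (gam : X -> R) (L r : R),
  [/\ enorm e = 1,
      (forall y z, `|gam y - gam z| <= L * enorm (y - z)),
      (forall y t, gam (y + t *: e) = gam y),
      0 < r &
      forall y, enorm (y - x) < r -> (Omega y <-> gam y < edot y e)].

Definition polyhedral_lipschitz_domain Omega : Prop :=
  [/\ [/\ open Omega, connected Omega & Omega !=set0], bounded_set Omega,
      polyhedral_boundary Omega & lipschitz_boundary Omega].

Definition bnd_partition Omega (G G' : set X) : Prop :=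
  G `|` G' = bnd Omega /\ G `&` G' = set0.

(* A simplex is given by the matrix whose rows are its d + 1 vertices;
   simplex_face T I is the convex hull of the vertices indexed by I. *)
Definition simplex_face (T : 'M[R]_(d.+1, d)) (I : pred 'I_d.+1) : set X :=
  [set x | exists l : 'rV[R]_d.+1,
    [/\ (forall i, 0 <= l ord0 i), (forall i, ~~ I i -> l ord0 i = 0),
        \sum_i l ord0 i = 1 & x = l *m T]].

Definition simplex_set (T : 'M[R]_(d.+1, d)) : set X := simplex_face T predT.

Definition affinely_independent (T : 'M[R]_(d.+1, d)) : bool :=
  \rank (row_mx (const_mx 1 : 'cV[R]_d.+1) T) == d.+1.

(* Conforming partition: two simplices meet in the face spanned by their
   common vertices. *)
Definition simplicial_partition Omega (M : seq 'M[R]_(d.+1, d)) : Prop :=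
  [/\ (forall T, T \in M -> affinely_independent T),
      closure Omega = [set x | exists2 T, T \in M & simplex_set T x] &
      forall T T', T \in M -> T' \in M ->
        simplex_set T `&` simplex_set T' =
        simplex_face T [pred i | [exists j, row i T == row j T']]].

Definition shape_regular (H : Type) (M : H -> seq 'M[R]_(d.+1, d)) : Prop :=
  exists2 sigma : R, 0 < sigma &
  forall h T, T \in M h ->
  exists (c : X) (rho : R),
    [set y | enorm (y - c) <= rho] `<=` simplex_set T /\
    (ediam (simplex_set T) <= (sigma * rho)%:E)%E.

End geometry.

Section sobolev.
Context {R : realType} {d : nat}.
Local Notation X := 'rV[R]_d.
Local Notation mu := (@lebesgue_rV R d).
Variable Omega : set X.
Implicit Types (f g : X -> R) (v w : 'I_d -> h1fun R d) (u q : h1fun R d).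

Definition partial (i : 'I_d) f : X -> R := 'D_(delta_mx ord0 i) f.

Fixpoint Ck (n : nat) f : Prop :=
  continuous f /\
  if n is n'.+1 then
    forall i, (forall x, derivable f x (delta_mx ord0 i)) /\ Ck n' (partial i f)
  else True.

Definition smooth f : Prop := forall n, Ck n f.

Definition test_function f : Prop :=
  smooth f /\
  exists K : set X, [/\ compact K, K `<=` Omega & forall x, ~ K x -> f x = 0].

Definition L2 : set (X -> R) :=
  [set f : X -> R | measurable_fun Omega f /\
           mu.-integrable Omega (fun x => (f x ^+ 2)%:E)].

Definition l2 f g : R := \int[mu]_(x in Omega) (f x * g x).

Definition l2norm f : R := Num.sqrt (l2 f f).

Definition weak_partial (i : 'I_d) f g : Prop :=
  forall phi, test_function phi -> l2 f (partial i phi) = - l2 g phi.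

(* An element of H^1(Omega) is represented by a pair of a function and its
   weak gradient, the latter being determined almost everywhere by the former;
   values outside Omega are irrelevant. *)
Definition H1 : set (h1fun R d) :=
  [set u | L2 u.1 /\ forall i, L2 (u.2 i) /\ weak_partial i u.1 (u.2 i)].

Definition h1norm u : R :=
  Num.sqrt (l2 u.1 u.1 + \sum_(i < d) l2 (u.2 i) (u.2 i)).

Definition with_gradient f : h1fun R d := (f, fun i => partial i f).

(* g is the boundary trace of u: by density of the smooth functions and
   continuity of the trace, it is the limit in L^2(bnd Omega) of phi n whenever
   phi n converges to u in H^1(Omega). The set function surface is integrated
   against Borel functions only, where it is a measure. *)
Definition is_trace u g : Prop :=
  measurable_fun [set: X] g /\
  exists phi : nat -> X -> R,
  [/\ (forall n, smooth (phi n)),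
      h1norm (u - with_gradient (phi n)) @[n --> \oo] --> (0 : R) &
      (\int[surface]_(x in bnd Omega) ((phi n x - g x) ^+ 2)%:E)%E
        @[n --> \oo] --> 0%E].

Definition zero_trace (G : set X) u : Prop :=
  exists2 g, is_trace u g & forall x, G x -> g x = 0.

Definition H1_0 (G : set X) : set (h1fun R d) := H1 `&` zero_trace G.

Definition H1_0_vec (G : set X) : set ('I_d -> h1fun R d) :=
  [set v | forall i, H1_0 G (v i)].

Definition h1norm_vec v : R := Num.sqrt (\sum_(i < d) h1norm (v i) ^+ 2).

Definition div v : X -> R := fun x => \sum_(i < d) (v i).2 i x.

Definition strain v (x : X) : 'M[R]_d :=
  \matrix_(i, j) (2^-1 * ((v i).2 j x + (v j).2 i x)).

End sobolev.

Section finite_elements.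
Context {R : realType} {d : nat}.
Local Notation X := 'rV[R]_d.
Variables (Omega : set X) (M : seq 'M[R]_(d.+1, d)) (G : set X).

Definition polynomial_fun (k : nat) (p : X -> R) : Prop :=
  exists c : {ffun 'I_d -> 'I_k.+1} -> R, forall x,
    p x = \sum_(m : {ffun 'I_d -> 'I_k.+1} | (\sum_i m i <= k)%N)
            c m * \prod_i x ord0 i ^+ m i.

Definition continuous_pw_polynomial (f : X -> R) : Prop :=
  {within closure Omega, continuous f} /\
  exists k, forall T, T \in M ->
    exists2 p, polynomial_fun k p & forall x, simplex_set T x -> f x = p x.

Definition finite_dim_subspace (W : lmodType R) (S : set W) : Prop :=
  exists n (b : 'I_n -> W),
    S = [set \sum_(i < n) c i *: b i | c in [set: 'I_n -> R]].

Definition fe_space (S : set (h1fun R d)) : Prop :=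
  [/\ finite_dim_subspace S, S `<=` H1_0 Omega G &
      forall q, S q -> continuous_pw_polynomial q.1].

Definition fe_space_vec (S : set ('I_d -> h1fun R d)) : Prop :=
  [/\ finite_dim_subspace S, S `<=` H1_0_vec Omega G &
      forall v, S v -> forall i, continuous_pw_polynomial (v i).1].

End finite_elements.

Section forms.
Context {R : realType} {d : nat}.
Local Notation X := 'rV[R]_d.
Local Notation tensor4 := ('I_d -> 'I_d -> 'I_d -> 'I_d -> R).
Implicit Types (v w : 'I_d -> h1fun R d) (q p th : h1fun R d).

Definition tensor_apply (C : tensor4) (E : 'M[R]_d) : 'M[R]_d :=
  \matrix_(i, j) \sum_k \sum_l C i j k l * E k l.

Definition frobenius (E F : 'M[R]_d) : R := \sum_i \sum_j E i j * F i j.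

Definition stiffness_tensor (Omega : set X) (C : X -> tensor4) : Prop :=
  [/\ (forall i j k l, measurable_fun Omega (fun x => C x i j k l)),
      (forall x, Omega x -> forall i j k l,
         C x i j k l = C x j i k l /\ C x i j k l = C x k l i j),
      (exists B : R, forall x, Omega x -> forall i j k l,
         `|C x i j k l| <= B) &
      (exists2 c : R, 0 < c & forall x, Omega x -> forall E : 'M[R]_d,
         E^T = E -> c * frobenius E E <= frobenius (tensor_apply (C x) E) E)].

Variables (Omega : set X) (C : X -> tensor4) (alphap alphath : R).

Definition a_u v w : R :=
  \int[lebesgue_rV d]_(x in Omega)
    frobenius (tensor_apply (C x) (strain v x)) (strain w x).

Definition b_form (alpha : R) q v : R := - alpha * l2 Omega q.1 (div v).

(* The condition h1norm_vec v != 0 says that v is nonzero as an element of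
   H^1; the supremum of the empty set is 0. *)
Definition inf_sup (Vh : set ('I_d -> h1fun R d)) (Qh Psih : set (h1fun R d))
    (Cis : R) : Prop :=
  forall q psi, Qh q -> Psih psi ->
  let chi : X -> R := alphap *: q.1 + alphath *: psi.1 in
  l2norm Omega chi <=
    Cis * sup [set `|l2 Omega chi (div v)| / h1norm_vec Omega v
              | v in Vh `&` [set v | h1norm_vec Omega v != 0]].

Variables (Vh : set ('I_d -> h1fun R d)) (S : 'M[R]_2).

Definition is_elastic_lift (y : h1fun R d * h1fun R d)
    (u : 'I_d -> h1fun R d) : Prop :=
  Vh u /\ forall v, Vh v ->
    a_u u v + b_form alphap y.1 v + b_form alphath y.2 v = 0.

(* The lift is unique up to a null set, and a_u does not depend on the
   representative that is chosen. *)
Definition elastic_lift (y : h1fun R d * h1fun R d) : 'I_d -> h1fun R d :=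
  xget 0 [set u | is_elastic_lift y u].

Definition storage_form (y z : h1fun R d * h1fun R d) : R :=
  \int[lebesgue_rV d]_(x in Omega)
    ((S 0 0 * y.1.1 x + S 0 1 * y.2.1 x) * z.1.1 x +
     (S 1 0 * y.1.1 x + S 1 1 * y.2.1 x) * z.2.1 x).

Definition m_eff (y z : h1fun R d * h1fun R d) : R :=
  storage_form y z + a_u (elastic_lift y) (elastic_lift z).

End forms.

(* Main.v *)
Require Import Defs.
From HB Require Import structures.
From mathcomp Require Import all_boot all_order all_algebra.
From mathcomp Require Import all_classical all_reals all_analysis.
From mathcomp Require Import measurable_realfun ring lra.

Set Implicit Arguments.
Unset Strict Implicit.
Unset Printing Implicit Defensive.
Import Order.TTheory GRing.Theory Num.Theory.
Import numFieldNormedType.Exports.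

Local Open Scope classical_set_scope.
Local Open Scope ring_scope.

(** Write [chi = alphap p + alphath th] for the combined pressure and [u] for the
    elastic lift of [(p, th)], so that [a_u u v = (chi, div v)] for every discrete
    [v]. The proof combines two sources of positivity.

    The energy of the lift controls [chi]. By the Cauchy-Schwarz inequality,
    [(chi, div v) = a_u u v] is at most the square root of [a_u u u * a_u v v],
    and [a_u v v] is at most a constant [K] times the squared [H^1] norm of [v].
    The inf-sup condition with constant [Cis] then bounds the squared norm of
    [chi] by [Cis ^ 2 * K * a_u u u] ([inf_sup_le_energy]). The bound is uniform
    in the mesh because [K] depends on the stiffness tensor only.

    Hence the effective mass form dominates the quadratic form of the 2 by 2
    matrix [N = S + kappa alpha^T alpha], with [kappa = 1 / (Cis ^ 2 * K)], in the
    Gram matrix of [p] and [th]. The semidefinite matrix [S] may be degenerate, but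
    [\det N] equals [\det S] plus [kappa] times the expression in the storage
    condition, so [\det N >= kappa * Cs > 0], and [N] is bounded below by
    [\det N / \tr N] ([det_trace_bound]).

    The lift is defined by choice, so its existence has to be shown as well
    ([elastic_liftP]). The divergence is the trace of the strain, whose [L^2] norm
    is controlled by the energy; therefore the functional [v |-> (chi, div v)] is
    dominated by the energy form, and a functional dominated by a positive
    semidefinite form on a finite-dimensional space is represented by that form
    ([psd_form_represent]). Applied to [l2] on the square-integrable functions
    and to [a_u] on the fields with square-integrable gradient, the lemmas on
    semidefinite forms provide all the Cauchy-Schwarz inequalities at once. *)

(** * Positive semidefinite forms on a subspace *)

Definition linear_subspace (R : realType) (W : lmodType R) (S : set W) : Prop :=
  S 0 /\ forall k u v, S u -> S v -> S (k *: u + v).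

(** Forms and functionals are functions on the whole of [W] with no property
    required outside [S]: integrals of products behave well only on
    square-integrable functions. *)
Definition linear_on (R : realType) (W : lmodType R) (S : set W) (f : W -> R)
  : Prop :=
  forall k u v, S u -> S v -> f (k *: u + v) = k * f u + f v.

Definition psd_form (R : realType) (W : lmodType R) (S : set W)
    (a : W -> W -> R) : Prop :=
  [/\ linear_subspace S, forall w, S w -> linear_on S (a^~ w),
      forall u v, S u -> S v -> a u v = a v u & forall u, S u -> 0 <= a u u].

Section psd_forms.
Context {R : realType} {W : lmodType R}.
Implicit Types (S : set W) (a : W -> W -> R) (f : W -> R).

Lemma finite_dim_linear_subspace S : finite_dim_subspace S -> linear_subspace S.
Proof.
move=> [n [b ->]]; split.
  by exists (fun=> 0) => //; apply: big1 => i _; rewrite scale0r.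
move=> k _ _ [c _ <-] [c' _ <-]; exists (fun i => k * c i + c' i) => //.
rewrite scaler_sumr -big_split /=; apply: eq_bigr => i _.
by rewrite scalerDl scalerA.
Qed.

Lemma linear_on_sum S f n (c : 'I_n -> R) (b : 'I_n -> W) :
  linear_subspace S -> linear_on S f -> (forall i, S (b i)) ->
  S (\sum_i c i *: b i) /\ f (\sum_i c i *: b i) = \sum_i c i * f (b i).
Proof.
move=> [S0 Slin] flin Sb.
have f0 : f 0 = 0.
  by have := flin (-1) 0 0 S0 S0; rewrite scaler0 addr0 mulN1r addNr.
apply: (big_ind2 (fun u r => S u /\ f u = r)) => [//|u r v s [Su <-] [Sv <-]|i _].
  by rewrite -{1 2}[u]scale1r flin// mul1r; split=> //; exact: Slin.
have := flin (c i) (b i) 0 (Sb i) S0; have := Slin (c i) (b i) 0 (Sb i) S0.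
by rewrite f0 !addr0.
Qed.

Lemma psd_form_subset S S' a :
  linear_subspace S -> S `<=` S' -> psd_form S' a -> psd_form S a.
Proof.
move=> subS SS' [_ alin asym apos]; split => //.
- by move=> w /SS' Sw k u v /SS' Su /SS' Sv; exact: alin.
- by move=> u v /SS' Su /SS' Sv; exact: asym.
- by move=> u /SS' Su; exact: apos.
Qed.

Lemma linear_subspace_comb S k l u v :
  linear_subspace S -> S u -> S v -> S (k *: u + l *: v).
Proof.
move=> [S0 Slin] Su Sv; apply: (Slin) => //.
by rewrite -[l *: v]addr0; exact: Slin.
Qed.

Lemma psd_form_combl S a k l u v w : psd_form S a -> S u -> S v -> S w ->
  a (k *: u + l *: v) w = k * a u w + l * a v w.
Proof.
move=> [[S0 Slin] alin _ _] Su Sv Sw.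
have a0 : a 0 w = 0.
  have := alin w Sw (-1) 0 0 S0 S0.
  by rewrite scaler0 addr0 mulN1r addNr.
rewrite alin//; last by rewrite -[l *: v]addr0; exact: Slin.
by rewrite -[l *: v]addr0 alin// a0 addr0.
Qed.

Lemma psd_form_quad S a k l u v : psd_form S a -> S u -> S v ->
  a (k *: u + l *: v) (k *: u + l *: v) =
  k ^+ 2 * a u u + 2 * k * l * a u v + l ^+ 2 * a v v.
Proof.
move=> apsd Su Sv; have [subS _ asym _] := apsd.
have Sw := linear_subspace_comb k l subS Su Sv.
rewrite (psd_form_combl _ _ apsd)//.
rewrite (asym u)// (asym v)// !(psd_form_combl _ _ apsd)// (asym v u)//.
by ring.
Qed.

(** Positivity is tested at [a u u *: v - a u v *: u]; when [a u u] and
    [a v v] both vanish this says nothing, and [u + v], [u - v] are used. *)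
Lemma psd_cauchy_schwarz S a : psd_form S a -> forall u v, S u -> S v ->
  a u v ^+ 2 <= a u u * a v v.
Proof.
move=> apsd u v Su Sv; have [subS _ _ apos] := apsd.
have quad_ge0 k l u' v' : S u' -> S v' ->
    0 <= k ^+ 2 * a u' u' + 2 * k * l * a u' v' + l ^+ 2 * a v' v'.
  move=> Su' Sv'; rewrite -(psd_form_quad _ _ apsd)//.
  by apply: (apos); exact: linear_subspace_comb.
have [u0 v0] := (apos u Su, apos v Sv).
have [uu0|uu0] := eqVneq (a u u) 0; last first.
  have upos : 0 < a u u by rewrite lt_def uu0.
  have := quad_ge0 (- a u v) (a u u) u v Su Sv.
  rewrite (_ : _ + _ = a u u * (a u u * a v v - a u v ^+ 2)); last by ring.
  by rewrite pmulr_rge0// subr_ge0.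
have [vv0|vv0] := eqVneq (a v v) 0; last first.
  have vpos : 0 < a v v by rewrite lt_def vv0.
  have := quad_ge0 (a v v) (- a u v) u v Su Sv.
  rewrite (_ : _ + _ = a v v * (a u u * a v v - a u v ^+ 2)); last by ring.
  by rewrite pmulr_rge0// subr_ge0.
have := quad_ge0 1 1 u v Su Sv; have := quad_ge0 1 (-1) u v Su Sv.
rewrite uu0 vv0 => h1 h2.
have -> : a u v = 0 by lra.
by rewrite expr0n mulr0.
Qed.

(** A semidefinite form represents every functional that it dominates: the
    domination makes the right-hand side orthogonal to the kernel of the Gram
    matrix, which is exactly solvability of the symmetric linear system. *)
Lemma psd_form_represent S a f K :
  finite_dim_subspace S -> psd_form S a -> linear_on S f ->
  (forall v, S v -> f v ^+ 2 <= K * a v v) ->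
  exists u, S u /\ forall v, S v -> a u v = f v.
Proof.
move=> /[dup] /finite_dim_linear_subspace subS [n [b defS]] [_ alin asym _].
move=> flin fdom.
have Sb i : S (b i).
  rewrite defS; exists (fun j => (j == i)%:R) => //.
  rewrite (bigD1 i)//= eqxx scale1r big1 ?addr0// => j /negPf ->.
  by rewrite scale0r.
pose comb c := \sum_(i < n) c i *: b i.
have Scomb c : S (comb c) by have [] := linear_on_sum c subS flin Sb.
have fcomb c : f (comb c) = \sum_i c i * f (b i).
  by have [] := linear_on_sum c subS flin Sb.
have acomb c w : S w -> a (comb c) w = \sum_i c i * a (b i) w.
  by move=> Sw; have [] := linear_on_sum c subS (alin w Sw) Sb.
pose A := \matrix_(i, j) a (b i) (b j); pose l := \row_j f (b j).
have : (l <= A)%MS.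
  rewrite submxE; apply/eqP/rowP => j; rewrite mxE [RHS]mxE.
  pose x i := cokermx A i j.
  have Ax0 i : \sum_k a (b i) (b k) * x k = 0.
    have := congr1 (fun B : 'M[R]_n => B i j) (mulmx_coker A).
    by rewrite !mxE => h; rewrite -[RHS]h; apply: eq_bigr => k _; rewrite mxE.
  have fx0 : f (comb x) = 0.
    apply/eqP; rewrite -sqrf_eq0 eq_le sqr_ge0 andbT.
    apply: (le_trans (fdom _ (Scomb x))).
    rewrite acomb// big1 ?mulr0// => i _.
    suff -> : a (b i) (comb x) = 0 by rewrite mulr0.
    rewrite asym// acomb// -[RHS](Ax0 i); apply: eq_bigr => k _.
    by rewrite mulrC asym.
  by rewrite -[RHS]fx0 fcomb; apply: eq_bigr => i _; rewrite mxE mulrC.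
move=> /submxP[D lDA]; exists (comb (D ord0)); split => // v.
rewrite {1}defS => -[c _ <-]; rewrite -/(comb c) acomb// fcomb.
transitivity (\sum_i \sum_j D ord0 i * (c j * a (b i) (b j))).
  apply: eq_bigr => i _; rewrite asym// acomb// mulr_sumr.
  by apply: eq_bigr => j _; rewrite (asym (b i)).
rewrite exchange_big; apply: eq_bigr => j _ /=.
have -> : f (b j) = l ord0 j by rewrite mxE.
rewrite lDA mxE mulr_sumr; apply: eq_bigr => i _; rewrite mxE.
by ring.
Qed.

End psd_forms.

(** * The inner product of square-integrable functions on an open set *)

Section l2_form.
Context {R : realType} {d : nat}.
Local Notation X := 'rV[R]_d.
Local Notation mu := (@lebesgue_rV R d).
Implicit Types (Omega : set X) (f g : X -> R).

(** An open set is the union of the open boxes with rational corners that it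
    contains, and there are countably many of those. *)
Lemma open_measurable_rV Omega : open Omega -> measurable Omega.
Proof.
move=> oO.
pose box (q : {ffun 'I_d -> rat * rat}) : set X := \bigcap_(i in [set: 'I_d])
  ((fun x : X => x ord0 i) @^-1` `]ratr (q i).1, ratr (q i).2[%classic).
have mbox q : measurable (box q).
  apply: fin_bigcap_measurable => [|i _]; first exact: finite_finset.
  rewrite -[X in measurable X]setTI.
  by apply: measurable_rV_coord => //; exact: measurable_itv.
pose F q := if pselect (box q `<=` Omega) then box q else set0.
have -> : Omega = \bigcup_q F q.
  apply/seteqP; split => [x Ox|x [q _]]; last first.
    by rewrite /F; case: pselect => // sub /sub.
  have /nbhs_ballP[e /= e0 xe] : nbhs x Omega by exact: open_nbhs_nbhs.
  have corner i : exists r : rat * rat, x ord0 i - e < ratr r.1 < x ord0 i /\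
      x ord0 i < ratr r.2 < x ord0 i + e.
    have [r] : exists r : rat, ratr r \in `]x ord0 i - e, x ord0 i[.
      by apply: rat_in_itvoo; rewrite ltrBlDr ltrDl.
    have [s] : exists s : rat, ratr s \in `]x ord0 i, x ord0 i + e[.
      by apply: rat_in_itvoo; rewrite ltrDl.
    by rewrite !in_itv /= => hs hr; exists (r, s).
  have [c cP] := choice corner.
  have cE i : [ffun i => c i] i = c i by rewrite ffunE.
  exists [ffun i => c i] => //; rewrite /F; case: pselect => [_ i _ /=|[]].
    rewrite in_itv /= cE; have [/andP[_ ->] /andP[-> _]] := cP i.
    by [].
  move=> y yc; apply: xe; split=> // i j; rewrite ord1 /ball /= ltr_norml.
  have := yc j I; rewrite /= in_itv /= cE.
  have [/andP[h1 h2] /andP[h3 h4]] := cP j => /andP[h5 h6].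
  by apply/andP; split; lra.
apply: countable_bigcupT_measurable => [|q]; first exact: countableP.
by rewrite /F; case: pselect => ?; [exact: mbox|exact: measurable0].
Qed.

Section measurable_domain.
Variable Omega : set X.
Hypothesis mO : measurable Omega.

Lemma integrable_EFin_sum (I : Type) (s : seq I) (F : I -> X -> R) :
  (forall i, mu.-integrable Omega (EFin \o F i)) ->
  mu.-integrable Omega (EFin \o (fun x => \sum_(i <- s) F i x)).
Proof.
move=> iF; apply: (eq_integrable mO (fun x => \sum_(i <- s) (EFin \o F i) x)%E).
  by move=> x _; rewrite /= sumEFin.
exact: integrable_sum.
Qed.

Lemma Rintegral_sum (I : Type) (s : seq I) (F : I -> X -> R) :
  (forall i, mu.-integrable Omega (EFin \o F i)) ->
  \int[mu]_(x in Omega) (\sum_(i <- s) F i x) =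
  \sum_(i <- s) \int[mu]_(x in Omega) F i x.
Proof.
move=> iF; elim: s => [|i s IH].
  transitivity (\int[mu]_(x in Omega) (0 : R)).
    by apply: eq_Rintegral => x _; rewrite big_nil.
  by rewrite big_nil Rintegral_cst// mul0r.
rewrite big_cons -IH -RintegralD//; last exact: integrable_EFin_sum.
by apply: eq_Rintegral => x _; rewrite big_cons.
Qed.

Lemma Rintegral_linear k f g :
  mu.-integrable Omega (EFin \o f) -> mu.-integrable Omega (EFin \o g) ->
  \int[mu]_(x in Omega) (k * f x + g x) =
  k * \int[mu]_(x in Omega) f x + \int[mu]_(x in Omega) g x.
Proof.
move=> iF iG; rewrite RintegralD// ?RintegralZl//.
apply: (eq_integrable mO (fun x => k%:E * (EFin \o f) x)%E) => //.
exact: integrableZl.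
Qed.

(** [|f g| <= f ^ 2 + g ^ 2]. *)
Lemma L2_mul_integrable f g : L2 Omega f -> L2 Omega g ->
  mu.-integrable Omega (EFin \o (fun x => f x * g x)).
Proof.
move=> [mf if2] [mg ig2].
apply: (le_integrable mO _ _ (integrableD mO if2 ig2)).
  by apply/measurable_EFinP; exact: measurable_funM.
move=> x _ /=; rewrite lee_fin normrM [leRHS]ger0_norm ?addr_ge0 ?sqr_ge0//.
rewrite -(real_normK (num_real (f x))) -(real_normK (num_real (g x))).
have := sqr_ge0 (`|f x| - `|g x|); have := normr_ge0 (f x).
have := normr_ge0 (g x); nra.
Qed.

Lemma L2_linear_subspace : linear_subspace (L2 Omega).
Proof.
split=> [|k f g Lf Lg].
  split; first exact: measurable_cst.
  apply: (eq_integrable mO (cst 0%E)) => [x _|]; last exact: integrable0.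
  by rewrite /= expr0n.
have [mf if2] := Lf; have [mg ig2] := Lg; split.
  by apply: measurable_funD => //; apply: measurable_funM => //; exact: measurable_cst.
apply: (eq_integrable mO (fun x => (k ^+ 2)%:E * (f x ^+ 2)%:E +
    (((2 * k)%:E * (f x * g x)%:E) + (g x ^+ 2)%:E))%E).
  move=> x _; rewrite -!EFinM -!EFinD; congr EFin.
  by rewrite /= (_ : (k *: f + g) x = k * f x + g x)//; ring.
apply: integrableD => //; first exact: integrableZl.
apply: integrableD => //; apply: integrableZl => //.
exact: L2_mul_integrable.
Qed.

Lemma L2_sum n (F : 'I_n -> X -> R) :
  (forall i, L2 Omega (F i)) -> L2 Omega (fun x => \sum_i F i x).
Proof.
move=> LF; have [L0 Llin] := L2_linear_subspace.
have -> : (fun x => \sum_i F i x) = \sum_i F i.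
  by apply/funext => x; rewrite fct_sumE.
apply: big_ind => // f g Lf Lg.
by rewrite -[f]scale1r; exact: Llin.
Qed.

Lemma l2_psd_form : psd_form (L2 Omega) (l2 Omega).
Proof.
split; first exact: L2_linear_subspace.
- move=> h Lh k f g Lf Lg; rewrite -Rintegral_linear; try exact: L2_mul_integrable.
  apply: eq_Rintegral => x _.
  by rewrite (_ : (k *: f + g) x = k * f x + g x)// mulrDl mulrA.
- by move=> f g _ _; apply: eq_Rintegral => x _; rewrite mulrC.
- by move=> f _; apply: Rintegral_ge0 => x _; rewrite -expr2 sqr_ge0.
Qed.

Lemma l2norm_sqr f : l2norm Omega f ^+ 2 = l2 Omega f f.
Proof.
by rewrite sqr_sqrtr//; apply: Rintegral_ge0 => x _; rewrite -expr2 sqr_ge0.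
Qed.

End measurable_domain.
End l2_form.

(** * Pointwise bounds for the strain and the stiffness tensor *)

Section tensors.
Context {R : realType} {d : nat}.
Local Notation X := 'rV[R]_d.
Local Notation tensor4 := ('I_d -> 'I_d -> 'I_d -> 'I_d -> R).
Implicit Types (E F G : 'M[R]_d) (c : tensor4) (v w : 'I_d -> h1fun R d).

Lemma frobenius_tensorE c E F : frobenius (tensor_apply c E) F =
  \sum_i \sum_j \sum_k \sum_l c i j k l * (E k l * F i j).
Proof.
apply: eq_bigr => i _; apply: eq_bigr => j _; rewrite mxE mulr_suml.
by apply: eq_bigr => k _; rewrite mulr_suml; apply: eq_bigr => l _; rewrite mulrA.
Qed.

Lemma frobenius_tensor_linear c k E F G :
  frobenius (tensor_apply c (k *: E + F)) G =
  k * frobenius (tensor_apply c E) G + frobenius (tensor_apply c F) G.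
Proof.
rewrite !frobenius_tensorE.
do 4![rewrite mulr_sumr -big_split; apply: eq_bigr => ? _ /=].
by rewrite !mxE; ring.
Qed.

Lemma frobenius_tensor_sym c E F : (forall i j k l, c i j k l = c k l i j) ->
  frobenius (tensor_apply c E) F = frobenius (tensor_apply c F) E.
Proof.
move=> csym; rewrite !frobenius_tensorE.
have pairs (h : tensor4) : \sum_i \sum_j \sum_k \sum_l h i j k l =
    \sum_(p : 'I_d * 'I_d) \sum_(q : 'I_d * 'I_d) h p.1 p.2 q.1 q.2.
  by rewrite pair_bigA; apply: eq_bigr => p _; rewrite pair_bigA.
rewrite (pairs (fun i j k l => c i j k l * (E k l * F i j))).
rewrite (pairs (fun i j k l => c i j k l * (F k l * E i j))) exchange_big /=.
by do 2![apply: eq_bigr => ? _]; rewrite csym (mulrC (E _ _)).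
Qed.

Lemma frobenius_ge0 E : 0 <= frobenius E E.
Proof. by do 2![apply: sumr_ge0 => ? _]; rewrite -expr2 sqr_ge0. Qed.

Lemma sqr_entry_le_frobenius E i j : E i j ^+ 2 <= frobenius E E.
Proof.
rewrite /frobenius (bigD1 i)//= (bigD1 j)//= expr2 -addrA lerDl addr_ge0//.
  by apply: sumr_ge0 => ? _; rewrite -expr2 sqr_ge0.
by do 2![apply: sumr_ge0 => ? _]; rewrite -expr2 sqr_ge0.
Qed.

Lemma mul_entry_le_frobenius E i j k l : `|E i j * E k l| <= frobenius E E.
Proof.
rewrite normrM; have := sqr_entry_le_frobenius E i j.
have := sqr_entry_le_frobenius E k l.
rewrite -(real_normK (num_real (E i j))) -(real_normK (num_real (E k l))).
by have := sqr_ge0 (`|E i j| - `|E k l|); nra.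
Qed.

Lemma ler_sum_ord n (F : 'I_n -> R) m :
  (forall i, F i <= m) -> \sum_i F i <= m *+ n.
Proof.
by move=> Fm; rewrite -[in leRHS](card_ord n) -sumr_const; exact: ler_sum.
Qed.

(** Each of the [d ^ 4] terms is bounded by [B] times the squared norm of [E]; the
    constant is crude, but only its independence of [E] is needed. *)
Lemma frobenius_tensor_le c B E : (forall i j k l, `|c i j k l| <= B) ->
  frobenius (tensor_apply c E) E <= (B * frobenius E E) *+ d *+ d *+ d *+ d.
Proof.
move=> cB; rewrite frobenius_tensorE.
do 4![apply: ler_sum_ord => ?].
apply: (le_trans (ler_norm _)); rewrite normrM ler_pM//.
exact: mul_entry_le_frobenius.
Qed.

Lemma sqr_mxtrace_le E : (\tr E) ^+ 2 <= frobenius E E *+ d *+ d.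
Proof.
rewrite expr2 mulr_suml; under eq_bigr do rewrite mulr_sumr.
do 2![apply: ler_sum_ord => ?].
exact: (le_trans (ler_norm _) (mul_entry_le_frobenius _ _ _ _ _)).
Qed.

Lemma strain_linear k v w (x : X) :
  strain (k *: v + w) x = k *: strain v x + strain w x.
Proof.
apply/matrixP => i j; rewrite !mxE.
have E a b : ((k *: v + w) a).2 b x = k * (v a).2 b x + (w a).2 b x by [].
by rewrite !E; ring.
Qed.

Lemma tr_strain v (x : X) : (strain v x)^T = strain v x.
Proof. by apply/matrixP => i j; rewrite !mxE addrC. Qed.

Lemma mxtrace_strain v (x : X) : \tr (strain v x) = div v x.
Proof. by apply: eq_bigr => i _; rewrite mxE; field. Qed.

(** Symmetrization is an orthogonal projection for the Frobenius product. *)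
Lemma frobenius_strain_le v (x : X) : frobenius (strain v x) (strain v x) <=
  \sum_i \sum_j (v i).2 j x * (v i).2 j x.
Proof.
pose g := fun i j => (v i).2 j x.
apply: (@le_trans _ _ (\sum_i \sum_j (2^-1 * g i j ^+ 2 + 2^-1 * g j i ^+ 2))).
  apply: ler_sum => i _; apply: ler_sum => j _.
  rewrite !mxE -/(g i j) -/(g j i).
  by have := sqr_ge0 (g i j - g j i); nra.
under eq_bigr do rewrite big_split; rewrite big_split /=.
rewrite [X in _ + X <= _]exchange_big /= -big_split /=.
apply: ler_sum => i _; rewrite -big_split; apply: ler_sum => j _ /=.
by rewrite -/(g i j); lra.
Qed.

End tensors.

(** * The elastic energy form *)

Section elasticity.
Context {R : realType} {d : nat}.
Local Notation X := 'rV[R]_d.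
Local Notation mu := (@lebesgue_rV R d).
Variables (Omega : set X) (C : X -> 'I_d -> 'I_d -> 'I_d -> 'I_d -> R).
Hypotheses (mO : measurable Omega) (hC : stiffness_tensor Omega C).
Implicit Types (u v w : 'I_d -> h1fun R d) (f g : X -> R).

Definition grad_L2 : set ('I_d -> h1fun R d) :=
  [set v | forall i j, L2 Omega ((v i).2 j)].

Lemma H1_0_vec_grad_L2 G : H1_0_vec Omega G `<=` grad_L2.
Proof. by move=> v vH i j; have [[_ /(_ j)[]]] := vH i. Qed.

Lemma grad_L2_linear_subspace : linear_subspace grad_L2.
Proof.
have [L0 Llin] := L2_linear_subspace mO.
by split=> [i j|k u v Lu Lv i j]; [exact: L0|exact: Llin].
Qed.

Lemma div_L2 v : grad_L2 v -> L2 Omega (div v).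
Proof. by move=> Lv; exact: (L2_sum mO). Qed.

Lemma strain_L2 v i j : grad_L2 v -> L2 Omega (fun x => strain v x i j).
Proof.
move=> Lv.
have -> : (fun x => strain v x i j) = 2^-1 *: (v i).2 j + 2^-1 *: (v j).2 i.
  by apply/funext => x; rewrite mxE mulrDr.
exact: (linear_subspace_comb _ _ (L2_linear_subspace mO)).
Qed.

Lemma elastic_integrable u v : grad_L2 u -> grad_L2 v ->
  mu.-integrable Omega (EFin \o (fun x =>
    frobenius (tensor_apply (C x) (strain u x)) (strain v x))).
Proof.
move=> Lu Lv; have [mC _ [B CB] _] := hC.
under [X in _ \o X]funext do rewrite frobenius_tensorE.
apply: (integrable_EFin_sum mO) => i; apply: (integrable_EFin_sum mO) => j.
apply: (integrable_EFin_sum mO) => k; apply: (integrable_EFin_sum mO) => l.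
apply: (eq_integrable mO (fun x : X => (C x i j k l)%:E *
    (EFin \o (fun y : X => (strain u y k l * strain v y i j)%R)) x)%E) => //.
apply: (integrableMr mO (h := fun x => C x i j k l)) => //; last first.
  by apply: L2_mul_integrable => //; exact: strain_L2.
exists B; split; first exact: num_real.
by move=> M BM x Ox /=; exact: le_trans (CB x Ox _ _ _ _) (ltW BM).
Qed.

Lemma a_u_psd_form : psd_form grad_L2 (a_u Omega C).
Proof.
have [_ Csym _ [c c0 Cc]] := hC; split; first exact: grad_L2_linear_subspace.
- move=> w Lw k u v Lu Lv; rewrite -Rintegral_linear//; try exact: elastic_integrable.
  by apply: eq_Rintegral => x _; rewrite strain_linear frobenius_tensor_linear.
- move=> u v _ _; apply: eq_Rintegral => x /set_mem Ox.
  by apply: frobenius_tensor_sym => i j k l; have [] := Csym x Ox i j k l.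
- move=> u _; apply: Rintegral_ge0 => x Ox.
  apply: le_trans (Cc x Ox _ (tr_strain u x)).
  by rewrite mulr_ge0 ?(ltW c0)// frobenius_ge0.
Qed.

Lemma div_linear k u v : div (k *: u + v) = k *: div u + div v.
Proof.
apply/funext => x; rewrite /div.
rewrite (_ : (_ + _) x = k * \sum_i (u i).2 i x + \sum_i (v i).2 i x)//.
by rewrite mulr_sumr -big_split.
Qed.

(** The divergence is the trace of the strain, which the pointwise coercivity of
    the tensor controls. The constant does not matter: this bound serves only to
    show that the functionals defining the lift vanish where the energy does. *)
Lemma div_le_a_u : exists K, forall v, grad_L2 v ->
  l2 Omega (div v) (div v) <= K * a_u Omega C v v.
Proof.
have [_ _ _ [c c0 Cc]] := hC; exists (c^-1 *+ d *+ d) => v Lv.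
rewrite /a_u -RintegralZl//; last exact: elastic_integrable.
apply: le_Rintegral => //; first by apply: L2_mul_integrable => //; exact: div_L2.
  apply: (eq_integrable mO (fun x => (c^-1 *+ d *+ d)%:E * (EFin \o (fun x =>
    frobenius (tensor_apply (C x) (strain v x)) (strain v x))) x)%E) => //.
  by apply: integrableZl => //; exact: elastic_integrable.
move=> x Ox; rewrite -expr2 -mxtrace_strain.
apply: (le_trans (sqr_mxtrace_le _)); rewrite !mulrnAl; do 2!apply: ler_wMn2r.
by rewrite mulrC ler_pdivlMr// mulrC Cc// tr_strain.
Qed.

(** Stated for the square of the full norm of [H^1], the one that occurs in the
    inf-sup condition; only the gradients contribute to the energy. *)
Lemma a_u_le_h1norm : exists2 K, 0 < K & forall v, grad_L2 v ->
  a_u Omega C v v <= K * h1norm_vec Omega v ^+ 2.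
Proof.
have [_ _ [B CB] _] := hC.
pose K := `|B| *+ d *+ d *+ d *+ d + 1.
have K0 : 0 < K by rewrite ltr_wpDl// !mulrn_wge0.
exists K => // v Lv.
pose g x := \sum_i \sum_j (v i).2 j x * (v i).2 j x.
have ig : mu.-integrable Omega (EFin \o g).
  by do 2![apply: (integrable_EFin_sum mO) => ?]; exact: L2_mul_integrable.
apply: (@le_trans _ _ (K * \int[mu]_(x in Omega) g x)).
  rewrite /a_u -RintegralZl//; apply: le_Rintegral => //.
  - exact: elastic_integrable.
  - apply: (eq_integrable mO (fun x => K%:E * (EFin \o g) x)%E) => //.
    exact: integrableZl.
  move=> x Ox; apply: (@le_trans _ _ (K * frobenius (strain v x) (strain v x))).
    apply: (le_trans (frobenius_tensor_le (B := `|B|) _ _)).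
      by move=> i j k l; exact: le_trans (CB x Ox i j k l) (ler_norm B).
    by rewrite /K mulrDl mul1r -!mulrnAl lerDl frobenius_ge0.
  by rewrite ler_wpM2l ?(ltW K0)// frobenius_strain_le.
rewrite ler_wpM2l ?(ltW K0)// /h1norm_vec sqr_sqrtr; last first.
  by apply: sumr_ge0 => i _; rewrite sqr_ge0.
rewrite Rintegral_sum//; last first.
  by move=> i; apply: (integrable_EFin_sum mO) => j; exact: L2_mul_integrable.
apply: ler_sum => i _; rewrite /h1norm Rintegral_sum//; last first.
  by move=> j; exact: L2_mul_integrable.
have l2_ge0 f : 0 <= l2 Omega f f.
  by apply: Rintegral_ge0 => x _; rewrite -expr2 sqr_ge0.
rewrite sqr_sqrtr ?lerDr//.
by rewrite addr_ge0//; apply: sumr_ge0 => j _.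
Qed.

End elasticity.

(** * The elastic lift and its energy *)

Section lift.
Context {R : realType} {d : nat}.
Local Notation X := 'rV[R]_d.
Variables (Omega : set X) (C : X -> 'I_d -> 'I_d -> 'I_d -> 'I_d -> R).
Hypotheses (mO : measurable Omega) (hC : stiffness_tensor Omega C).
Variables (alphap alphath : R) (Vh : set ('I_d -> h1fun R d)).
Hypotheses (Vfin : finite_dim_subspace Vh) (VL2 : Vh `<=` grad_L2 Omega).
Variables p th : h1fun R d.
Hypotheses (Lp : L2 Omega p.1) (Lth : L2 Omega th.1).

Let chi : X -> R := alphap *: p.1 + alphath *: th.1.
Let lift := elastic_lift Omega C alphap alphath Vh (p, th).

Let Lchi : L2 Omega chi.
Proof. exact: (linear_subspace_comb _ _ (L2_linear_subspace mO)). Qed.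

Let l2_chiE f : L2 Omega f ->
  l2 Omega chi f = alphap * l2 Omega p.1 f + alphath * l2 Omega th.1 f.
Proof. exact: (psd_form_combl _ _ (l2_psd_form mO)). Qed.

(** On functions without elastic energy the divergence vanishes, so the pressure
    functional is dominated by the energy form and is represented on the
    finite-dimensional space; any choice of representative will do. *)
Lemma elastic_liftP :
  Vh lift /\ forall v, Vh v -> a_u Omega C lift v = l2 Omega chi (div v).
Proof.
suff liftP : is_elastic_lift Omega C alphap alphath Vh (p, th) lift.
  split=> [|v Vv]; first by case: liftP.
  have [_ /(_ v Vv)] := liftP; rewrite /b_form l2_chiE/=; last exact/(div_L2 mO)/VL2.
  by lra.
apply: xgetPex.
have [K divK] := div_le_a_u mO hC.
have subV := finite_dim_linear_subspace Vfin.
have apsd : psd_form Vh (a_u Omega C).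
  exact: psd_form_subset subV VL2 (a_u_psd_form mO hC).
have [_ l2lin l2sym _] := l2_psd_form mO.
have Ldiv v : Vh v -> L2 Omega (div v) by move=> /VL2; exact: div_L2.
have [||u [Vu uP]] := psd_form_represent (f := fun v => l2 Omega chi (div v))
    (K := l2 Omega chi chi * K) Vfin apsd.
- move=> k u v /Ldiv Lu /Ldiv Lv.
  rewrite div_linear (l2sym chi)//; last first.
    by have [_ Llin] := L2_linear_subspace mO; exact: Llin.
  by rewrite l2lin// (l2sym chi)// (l2sym chi (div v)).
- move=> v Vv; apply: (le_trans (psd_cauchy_schwarz (l2_psd_form mO) Lchi (Ldiv v Vv))).
  rewrite -mulrA ler_wpM2l ?divK//; last exact: VL2.
  by have [_ _ _ ->] := l2_psd_form mO.
exists u; split => // v Vv; rewrite uP// /b_form l2_chiE/=; last exact: Ldiv.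
by lra.
Qed.

(** Each quotient in the inf-sup supremum is [a_u lift v] over the norm of [v],
    hence at most the square root of the energy of the lift times the continuity
    constant of [a_u], by the Cauchy-Schwarz inequality for [a_u]. *)
Lemma inf_sup_le_energy K Cis : 0 < K -> 0 < Cis ->
  (forall v, Vh v -> a_u Omega C v v <= K * h1norm_vec Omega v ^+ 2) ->
  l2norm Omega chi <= Cis * sup [set `|l2 Omega chi (div v)| / h1norm_vec Omega v
              | v in Vh `&` [set v | h1norm_vec Omega v != 0]] ->
  l2 Omega chi chi <= Cis ^+ 2 * K * a_u Omega C lift lift.
Proof.
move=> K0 Cis0 aK chi_sup; have [Vlift liftE] := elastic_liftP.
have [_ _ _ a0] := a_u_psd_form mO hC.
have E0 : 0 <= a_u Omega C lift lift by exact/a0/VL2.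
have KE0 : 0 <= K * a_u Omega C lift lift by rewrite mulr_ge0// ltW.
rewrite -l2norm_sqr -mulrA -(sqr_sqrtr KE0) -exprMn lerXn2r ?nnegrE ?sqrtr_ge0//.
  by rewrite mulr_ge0 ?sqrtr_ge0// ltW.
apply: (le_trans chi_sup); rewrite ler_wpM2l ?(ltW Cis0)//.
(* the empty supremum is 0, which the square root bounds as well *)
set Q := [set _ | _ in _].
have [->|Q0] := eqVneq Q set0; first by rewrite sup0 sqrtr_ge0.
apply: ge_sup; first exact/set0P.
move=> _ [v [Vv /= v0] <-].
have vpos : 0 < h1norm_vec Omega v by rewrite lt_def v0 sqrtr_ge0.
rewrite ler_pdivrMr// -liftE//.
rewrite -ler_sqr ?nnegrE ?mulr_ge0 ?sqrtr_ge0 ?(ltW vpos)//.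
rewrite exprMn sqr_sqrtr// real_normK ?num_real//.
apply: le_trans (psd_cauchy_schwarz (a_u_psd_form mO hC) _ _) _; try exact: VL2.
by rewrite (mulrC K) -mulrA ler_wpM2l// aK.
Qed.

End lift.

(** * Coercivity of the effective mass form *)

(** With [N] the symmetric matrix of entries [n1], [n2], [n3], the difference of
    the two sides is the squared norm of [N (u, v)], because
    [N ^ 2 = \tr N * N - \det N] by the Cayley-Hamilton theorem. When [\det N]
    and [\tr N] are positive this bounds the lowest eigenvalue of [N] from below
    by their quotient. *)
Lemma det_trace_bound (R : realType) (W : lmodType R) (S : set W) a :
  psd_form S a -> forall n1 n2 n3 u v, S u -> S v ->
  (n1 * n3 - n2 ^+ 2) * (a u u + a v v) <=
  (n1 + n3) * (n1 * a u u + 2 * n2 * a u v + n3 * a v v).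
Proof.
move=> apsd n1 n2 n3 u v Su Sv; have [subS _ _ apos] := apsd.
have := apos _ (linear_subspace_comb n1 n2 subS Su Sv).
rewrite (psd_form_quad _ _ apsd)// => h1.
have := apos _ (linear_subspace_comb n2 n3 subS Su Sv).
rewrite (psd_form_quad _ _ apsd)// => h2.
rewrite -subr_ge0; apply: le_trans (addr_ge0 h1 h2) _.
by rewrite le_eqVlt; apply/orP; left; apply/eqP; ring.
Qed.

(** The Gram entries of the form [x S y^T] on the canonical basis are those of
    [S], so the determinant inequality is a Cauchy-Schwarz inequality. *)
Lemma psd_mx2 (R : realType) (S : 'M[R]_2) : S^T = S ->
  (forall x : 'rV[R]_2, 0 <= (x *m S *m x^T) 0 0) ->
  [/\ 0 <= S 0 0, 0 <= S 1 1 & S 0 1 ^+ 2 <= S 0 0 * S 1 1].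
Proof.
move=> Ssym Spos.
pose a (x y : 'rV[R]_2) := (x *m S *m y^T) 0 0.
have apsd : psd_form [set: 'rV[R]_2] a.
  split; first by split.
  - by move=> z _ k x y _ _; rewrite /a !mulmxDl -!scalemxAl !mxE.
  - move=> x y _ _; have -> : a y x = (x *m S *m y^T)^T 0 0.
      by rewrite !trmx_mul trmxK Ssym mulmxA.
    by rewrite mxE.
  - by move=> x _; exact: Spos.
pose e i : 'rV[R]_2 := delta_mx 0 i.
have aE i j : a (e i) (e j) = S i j.
  by rewrite /a trmx_delta -rowE -colE !mxE.
have [_ _ _ a0] := apsd; split; first by rewrite -aE a0.
  by rewrite -aE a0.
by have := psd_cauchy_schwarz apsd (u := e 0) (v := e 1) I I; rewrite !aE.
Qed.

Lemma storage_formE (R : realType) (d : nat) (Omega : set 'rV[R]_d)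
    (S : 'M[R]_2) (p th : h1fun R d) :
  measurable Omega -> S^T = S -> L2 Omega p.1 -> L2 Omega th.1 ->
  storage_form Omega S (p, th) (p, th) =
  S 0 0 * l2 Omega p.1 p.1 + 2 * S 0 1 * l2 Omega p.1 th.1 +
  S 1 1 * l2 Omega th.1 th.1.
Proof.
move=> mO Ssym Lp Lth; have l2psd := l2_psd_form mO; have [subL2 _ l2sym _] := l2psd.
have S10 : S 1 0 = S 0 1 by rewrite -{1}Ssym mxE.
transitivity (l2 Omega (S 0 0 *: p.1 + S 0 1 *: th.1) p.1 +
    l2 Omega (S 1 0 *: p.1 + S 1 1 *: th.1) th.1).
  rewrite -RintegralD//; apply: L2_mul_integrable => //;
    exact: linear_subspace_comb.
rewrite !(psd_form_combl _ _ l2psd)// (l2sym th.1)// S10.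
by ring.
Qed.

Theorem lemma4p1 (R : realType) (d : nat) (hd : d = 2%N \/ d = 3%N)
  (Omega : set 'rV[R]_d) (hOmega : polyhedral_lipschitz_domain Omega)
  (Gp Gf Gd Gt Gth Gthf : set 'rV[R]_d)
  (hGpf : bnd_partition Omega Gp Gf)
  (hGdt : bnd_partition Omega Gd Gt)
  (hGth : bnd_partition Omega Gth Gthf)
  (hGp0 : (0 < surface Gp)%E) (hGd0 : (0 < surface Gd)%E)
  (hGt0 : (0 < surface Gt)%E) (hGth0 : (0 < surface Gth)%E)
  (C : 'rV[R]_d -> 'I_d -> 'I_d -> 'I_d -> 'I_d -> R)
  (hC : stiffness_tensor Omega C)
  (alphap alphath : R) (halphap : 0 < alphap) (halphath : 0 < alphath)
  (S : 'M[R]_2) (hSsym : S^T = S)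
  (hSpsd : forall x : 'rV[R]_2, 0 <= (x *m S *m x^T) 0 0)
  (Cs : R) (hCs : 0 < Cs)
  (hstorage : Cs <= alphath ^+ 2 * S 0 0 - 2 * alphap * alphath * S 0 1
                    + alphap ^+ 2 * S 1 1)
  (H : Type) (M : H -> seq 'M[R]_(d.+1, d))
  (hM : forall h, simplicial_partition Omega (M h)) (hMreg : shape_regular M)
  (Vh : H -> set ('I_d -> h1fun R d)) (Qh Psih : H -> set (h1fun R d))
  (hVh : forall h, fe_space_vec Omega (M h) Gd (Vh h))
  (hQh : forall h, fe_space Omega (M h) Gp (Qh h))
  (hPsih : forall h, fe_space Omega (M h) Gth (Psih h))
  (hinfsup : exists2 Cis : R, 0 < Cis & forall h,
     inf_sup Omega alphap alphath (Vh h) (Qh h) (Psih h) Cis) :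
  exists2 Ceff : R, 0 < Ceff &
    forall (h : H) (p th : h1fun R d), Qh h p -> Psih h th ->
      Ceff * (l2norm Omega p.1 ^+ 2 + l2norm Omega th.1 ^+ 2) <=
      m_eff Omega C alphap alphath (Vh h) S (p, th) (p, th).
Proof.
have mO : measurable Omega by case: hOmega => -[/open_measurable_rV].
have [S0 S1 Sdet] := psd_mx2 hSsym hSpsd.
have [Cis Cis0 infsup] := hinfsup.
have [K K0 aK] := a_u_le_h1norm mO hC.
pose kappa := (Cis ^+ 2 * K)^-1.
have kappa0 : 0 < kappa by rewrite invr_gt0 mulr_gt0// exprn_gt0.
(* n1, n2, n3 are the entries of S + kappa * alpha^T alpha: the lift contributes
   at least kappa times the squared norm of the combined pressure *)
pose n1 := S 0 0 + kappa * alphap ^+ 2.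
pose n2 := S 0 1 + kappa * (alphap * alphath).
pose n3 := S 1 1 + kappa * alphath ^+ 2.
have tr0 : 0 < n1 + n3.
  by rewrite addr_gt0// ltr_wpDl// mulr_gt0// exprn_gt0.
have det_ge : kappa * Cs <= n1 * n3 - n2 ^+ 2.
  (* a rank-one update adds alpha adj(S) alpha^T to the determinant, which is the
     quantity bounded by the storage condition *)
  have -> : n1 * n3 - n2 ^+ 2 = (S 0 0 * S 1 1 - S 0 1 ^+ 2) + kappa *
    (alphath ^+ 2 * S 0 0 - 2 * alphap * alphath * S 0 1 + alphap ^+ 2 * S 1 1).
    by rewrite /n1 /n2 /n3; ring.
  by rewrite ler_wpDl ?subr_ge0// ler_pM2l.
exists (kappa * Cs / (n1 + n3)); first by rewrite divr_gt0// mulr_gt0.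
move=> h p th Qp Pth.
have Lp : L2 Omega p.1 by have [_ /(_ _ Qp)[[]]] := hQh h.
have Lth : L2 Omega th.1 by have [_ /(_ _ Pth)[[]]] := hPsih h.
have [Vfin Vsub _] := hVh h.
have VL2 : Vh h `<=` grad_L2 Omega by move=> v /Vsub; exact: H1_0_vec_grad_L2.
have l2psd := l2_psd_form mO; have [_ _ _ l2_ge0] := l2psd.
have := inf_sup_le_energy mO hC Vfin VL2 Lp Lth K0 Cis0
  (fun v Vv => aK v (VL2 v Vv)) (infsup h p th Qp Pth).
rewrite -ler_pdivrMl ?mulr_gt0 ?exprn_gt0// -/kappa (psd_form_quad _ _ l2psd)//.
move=> energy.
rewrite !l2norm_sqr mulrAC ler_pdivrMr//.
apply: (@le_trans _ _ ((n1 * n3 - n2 ^+ 2) *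
    (l2 Omega p.1 p.1 + l2 Omega th.1 th.1))).
  by rewrite ler_wpM2r// addr_ge0// l2_ge0.
apply: le_trans (det_trace_bound l2psd n1 n2 n3 Lp Lth) _.
rewrite mulrC ler_pM2r// /m_eff storage_formE//.
apply: le_trans (lerD (lexx _) energy).
by rewrite le_eqVlt /n1 /n2 /n3; apply/orP; left; apply/eqP; ring.
Qed.
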